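(* Let $X$ be a separable infinite dimensional Banach space over $\mathbb{C}$ with a Schauder basis, and let $\lambda\in\mathbb{C}$ with $|\lambda|=1$. If $S\in\mathcal{B}(X)$ is a weighted forward shift or a weighted bilateral shift on a normalised basis for $X$ with weights $w_j$ such that there exists a strictly increasing sequence of indices $(n_j)_{j\ge1}$ with $|w_{n_j}|\to0$ as $j\to\infty$, then $\lambda I+S$ lies in the operator norm closure of the set of mixing operators on $X$. In particular, if $S$ is a quasinilpotent forward or bilateral (weighted) shift on a normalised basis for $X$, then $\lambda I+S$ lies in the operator norm closure of the set of mixing operators on $X$.
   Context: $\mathcal{B}(X)$ denotes the bounded linear operators on $X$; $I$ is the identity operator. An operator $T\in\mathcal{B}(X)$ is mixing if for each pair $U,V$ of nonempty open subsets of $X$ there is $N$ such that $T^n(U)\cap V\neq\emptyset$ for all $n>N$. An operator is quasinilpotent if its spectrum is $\{0\}$. A basis is normalised if all its vectors have norm $1$. A (weighted) forward shift with respect to a Schauder basis $\{x_n\}_{n=1}^\infty$ of $X$ is an operator $S\in\mathcal{B}(X)$ with $Sx_n=w_nx_{n+1}$ for all $n\ge1$, where $w_n\in\mathbb{C}$ are the weights. A (weighted) bilateral shift is an operator $S\in\mathcal{B}(X)$ with $Sx_n=w_nx_{n+1}$ for all $n\in\mathbb{Z}$, where $\{x_n\}_{n=-\infty}^\infty$ is a basis of $X$ indexed by $\mathbb{Z}$ (that is, a Schauder basis of $X$ for some enumeration of the index set $\mathbb{Z}$) and $w_n\in\mathbb{C}$. In the bilateral case the indices $n_j$ are integers; in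 the forward case they are positive integers. *)

(* Defs.v *)
From HB Require Import structures.
From mathcomp Require Export all_boot all_order all_algebra.
From mathcomp Require Export all_classical all_reals all_analysis.
From mathcomp Require Export complex.

Set Implicit Arguments.
Unset Strict Implicit.
Unset Printing Implicit Defensive.

Export Order.TTheory GRing.Theory Num.Theory.
Export numFieldNormedType.Exports.

#[global] Open Scope classical_set_scope.
#[global] Open Scope ring_scope.

(** Complex Banach spaces are objects [X : completeNormedModType R[i]]; the norm
    of such a space takes its values in the nonnegative reals of [R[i]]. *)

Section Defs.
Context {R : realType} {X : completeNormedModType R[i]}.
Local Notation C := (R[i]).
Implicit Types (S T A : {linear X -> X}).

Definition separable (Y : topologicalType) :=
  exists2 D : set Y, countable D & dense D.

Definition infinite_dimensional (Y : lmodType C) :=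
  forall (n : nat) (v : 'I_n -> Y),
    ~ (forall y : Y, exists c : 'I_n -> C, y = \sum_(i < n) c i *: v i).

(** Equivalent to continuity by [linear_bounded_continuous] and to
    [`|T x| <= M * `|x|] by [linear_boundedP]. *)
Definition bounded_operator T := bounded_near T (nbhs (0 : X)).

(** [Re] only turns the norm, a nonnegative real of [R[i]], into an element of
    [R]. Junk value [0] when [T] is unbounded. *)
Definition opnorm T : R :=
  sup [set complex.Re (`|T x| : C) | x in [set x : X | `|x| <= 1]].

(** Closure in the normed space of bounded operators; [opnorm] is meaningful
    below because [A] and the elements of [M] are required to be bounded. *)
Definition opnorm_closure (M : set {linear X -> X}) : set {linear X -> X} :=
  [set A | bounded_operator A /\
     forall eps : R, 0 < eps ->
       exists T, [/\ bounded_operator T, M T & opnorm (T \- A) < eps]].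

Definition mixing T :=
  forall U V : set X, open U -> U !=set0 -> open V -> V !=set0 ->
    exists N : nat, forall n : nat, (N < n)%N ->
      (iter n T @` U) `&` V !=set0.

Definition spectrum T : set C :=
  [set z | ~ exists A, [/\ bounded_operator A,
     forall x, A (z *: x - T x) = x & forall x, z *: A x - T (A x) = x]].

Definition quasinilpotent T := spectrum T = [set 0].

Definition schauder_basis (x : nat -> X) :=
  forall v : X, exists! a : nat -> C,
    series (fun n => a n *: x n) @ \oo --> v.

Definition schauder_basis_int (x : int -> X) :=
  exists2 e : nat -> int, bijective e & schauder_basis (x \o e).

Definition normalised (I : Type) (x : I -> X) := forall i, `|x i| = 1.

(** The basis [x_1, x_2, ...] is indexed from [0]: [x n] and [w n] stand for
    [x_(n+1)] and [w_(n+1)]. *)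
Definition forward_shift (x : nat -> X) (w : nat -> C) T :=
  [/\ bounded_operator T, schauder_basis x &
      forall n : nat, T (x n) = w n *: x n.+1].

Definition bilateral_shift (x : int -> X) (w : int -> C) T :=
  [/\ bounded_operator T, schauder_basis_int x &
      forall n : int, T (x n) = w n *: x (n + 1)].

Definition weights_vanish_nat (w : nat -> C) :=
  exists n : nat -> nat, {homo n : i j / (i < j)%N >-> (i < j)%N} /\
    (fun j => `|w (n j)| : C^o) @ \oo --> (0 : C^o).

Definition weights_vanish_int (w : int -> C) :=
  exists n : nat -> int, {homo n : i j / (i < j)%N >-> i < j} /\
    (fun j => `|w (n j)| : C^o) @ \oo --> (0 : C^o).

End Defs.

(* Main.v *)
Require Import Defs.
From HB Require Import structures.
From mathcomp Require Import ring lra zify.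

(** Since the coefficient functionals of a normalised basis are uniformly
    bounded, changing an operator on the basis by a summable amount changes it
    little in norm. So we may cut the shift at infinitely many indices
    [c_0 < c_1 < ...] with rapidly decreasing weights, make the other weights
    nonzero, and send [x_(c_j)] to a small multiple of the vector that follows
    [x_(c_(j-2))]. The result [L] moves each basis vector along a path that ends
    in [0], and each path extends backwards indefinitely. For such an [L],
    [lambda + L] is mixing: every basis vector lies at the end of arbitrarily
    long Jordan chains, on which [lambda + L] acts, up to the factor [lambda],
    as the translation of polynomials, and polynomials of large degree
    interpolate between prescribed values near [0] and near [k].

    If the weights of a quasinilpotent shift were bounded below on a tail, then
    for small [s > 0] the coefficients of [(s - S)^-1 x_N] along that tail would
    not tend to [0], provided this vector has no coefficients off the tail; the
    latter holds for large [s] and extends to all [s > 0] by connectedness. *)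

Set Implicit Arguments.
Unset Strict Implicit.
Unset Printing Implicit Defensive.

Local Open Scope complex_scope.


(** * Real-valued norms and convergence of sequences *)

Section RealNorm.
Context {R : realType}.
Implicit Type V : normedModType R[i].

(** Norms take values in [R[i]]; passing to [R] makes the order total, so that real arithmetic and
    infima are available. *)
Definition rnorm {V : normedZmodType R[i]} (x : V) : R := complex.Re `|x|.

Lemma rnormE (V : normedZmodType R[i]) (x : V) : `|x| = (rnorm x)%:C.
Proof. by rewrite /rnorm RRe_real// normr_real. Qed.

Lemma rnorm_ge0 (V : normedZmodType R[i]) (x : V) : 0 <= rnorm x.
Proof. by rewrite -ler0c -rnormE. Qed.

Lemma rnormD (V : normedZmodType R[i]) (x y : V) :
  rnorm (x + y) <= rnorm x + rnorm y.
Proof. by rewrite -lecR rmorphD/= -!rnormE ler_normD. Qed.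

Lemma rnormN (V : normedZmodType R[i]) (x : V) : rnorm (- x) = rnorm x.
Proof. by rewrite /rnorm normrN. Qed.

Lemma rnormB (V : normedZmodType R[i]) (x y : V) :
  rnorm (x - y) <= rnorm x + rnorm y.
Proof. by rewrite -(rnormN y) rnormD. Qed.

Lemma rdistC (V : normedZmodType R[i]) (x y : V) : rnorm (x - y) = rnorm (y - x).
Proof. by rewrite -rnormN opprB. Qed.

Lemma rdistD (V : normedZmodType R[i]) (x y z : V) :
  rnorm (x - z) <= rnorm (x - y) + rnorm (y - z).
Proof. by rewrite (le_trans _ (rnormD _ _))// addrA subrK. Qed.

Lemma rnorm0 (V : normedZmodType R[i]) : rnorm (0 : V) = 0.
Proof. by rewrite /rnorm normr0. Qed.

Lemma rnorm_eq0 (V : normedZmodType R[i]) (x : V) : (rnorm x == 0) = (x == 0).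
Proof. by rewrite -[RHS]normr_eq0 rnormE (inj_eq (@complexI R) _ 0). Qed.

Lemma rnorm_gt0 (V : normedZmodType R[i]) (x : V) : (0 < rnorm x) = (x != 0).
Proof. by rewrite lt0r rnorm_eq0 rnorm_ge0 andbT. Qed.

Lemma rnormZ V (a : R[i]) (x : V) : rnorm (a *: x) = rnorm a * rnorm x.
Proof. by apply: (@complexI R); rewrite rmorphM/= -!rnormE normrZ. Qed.

Lemma rnormM (a b : R[i]) : rnorm (a * b) = rnorm a * rnorm b.
Proof. by apply: (@complexI R); rewrite rmorphM/= -!rnormE normrM. Qed.

Lemma rnormV (a : R[i]) : rnorm a^-1 = (rnorm a)^-1.
Proof. by apply: (@complexI R); rewrite fmorphV/= -!rnormE normfV. Qed.

Lemma rnormX (a : R[i]) n : rnorm (a ^+ n) = rnorm a ^+ n.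
Proof. by apply: (@complexI R); rewrite rmorphXn/= -!rnormE normrX. Qed.

Lemma rnorm_real (r : R) : rnorm r%:C = `|r|.
Proof.
by rewrite /rnorm normc_def /= expr0n addr0 sqrtr_sqr.
Qed.

Lemma rnormZr V (r : R) (x : V) : 0 <= r -> rnorm (r%:C *: x) = r * rnorm x.
Proof. by move=> r0; rewrite rnormZ rnorm_real ger0_norm. Qed.

Lemma cvg_rnormP V (u : nat -> V) (l : V) :
  u @ \oo --> l <->
  forall e : R, 0 < e -> exists N, forall n, (N <= n)%N -> rnorm (u n - l) < e.
Proof.
split=> [/cvgrPdist_lt ul e e0|ul].
  have /ul [N _ HN] : (0 : R[i]) < e%:C by rewrite ltcR.
  by exists N => n /HN; rewrite rdistC rnormE ltcR.
apply/cvgrPdist_lt => e e0.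
have er : e = (complex.Re e)%:C by rewrite RRe_real// gtr0_real.
move: e0; rewrite er ltcR => /ul [N HN].
by exists N => // n /HN; rewrite rdistC rnormE ltcR.
Qed.

Lemma cvg_rnorm0 V (u : nat -> V) (l : V) :
  u @ \oo --> l <-> (fun n => rnorm (u n - l)) @ \oo --> (0 : R).
Proof.
split=> [/cvg_rnormP ul|/cvgrPdist_lt ul].
  apply/cvgrPdist_lt => e /ul [N HN]; exists N => // n /HN.
  by rewrite sub0r normrN ger0_norm// rnorm_ge0.
apply/cvg_rnormP => e /ul [N _ HN]; exists N => n /HN.
by rewrite sub0r normrN ger0_norm// rnorm_ge0.
Qed.

Lemma cvg_rnorm_squeeze V (u : nat -> V) (l : V) (b : nat -> R) :
  (forall n, rnorm (u n - l) <= b n) -> b @ \oo --> (0 : R) -> u @ \oo --> l.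
Proof.
move=> ub b0; apply/cvg_rnorm0.
apply: (squeeze_cvgr _ (cvg_cst _) b0).
by apply: nearW => n; rewrite rnorm_ge0 ub.
Qed.

Lemma rnorm_cvg_le V (u : nat -> V) (l y : V) (b : R) :
  u @ \oo --> l -> (exists N, forall n, (N <= n)%N -> rnorm (u n - y) <= b) ->
  rnorm (l - y) <= b.
Proof.
move=> /cvg_rnormP ul [N uy]; apply/ler_addgt0Pr => e /ul [N' uN'].
rewrite (le_trans (rdistD _ (u (maxn N N')) _))// addrC lerD//.
  by rewrite uy// leq_maxl.
by rewrite rdistC ltW// uN'// leq_maxr.
Qed.

Lemma cvg_half_expr (c : R) : (fun n => c * 2^-1 ^+ n) @ \oo --> (0 : R).
Proof.
rewrite -(mulr0 c); apply: cvgM; first exact: cvg_cst.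
by apply: cvg_expr; rewrite ger0_norm ?invr_ge0// invf_lt1// ltr1n.
Qed.

Lemma cvg_cauchy_bound (K : numFieldType) (V : completeNormedModType K)
    (u : nat -> V) (b : nat -> K) :
  (forall n m, (n <= m)%N -> `|u m - u n| <= b n) -> b @ \oo --> (0 : K) ->
  cvgn u.
Proof.
move=> ub /cvgrPdist_lt b0; apply/cauchy_cvgP/cauchy_exP => e e0.
have [N _ bN] := b0 _ e0.
exists (u N); exists N => // m /= Nm; rewrite -ball_normE /ball_/= distrC.
have := bN N (leqnn _); rewrite sub0r normrN.
have h := ub _ _ Nm.
by rewrite ger0_norm ?(le_trans _ h)//; exact: le_lt_trans.
Qed.

End RealNorm.

(** * Completeness with explicit rates *)

Section Complete.
Context {R : realType}.

Lemma realC_cvg0 (b : nat -> R) : b @ \oo --> (0 : R) ->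
  (fun n => (b n)%:C : R[i]^o) @ \oo --> (0 : R[i]^o).
Proof.
move=> b0; apply/(@cvg_rnormP _ (R[i]^o)) => e e0.
move/cvgrPdist_lt: b0 => /(_ _ e0) [N _ HN]; exists N => n /HN.
by rewrite sub0r normrN subr0 rnorm_real.
Qed.

Lemma cvg_rcauchy (X : completeNormedModType R[i]) (u : nat -> X)
    (b : nat -> R) :
  (forall n m, (n <= m)%N -> rnorm (u m - u n) <= b n) -> b @ \oo --> (0 : R) ->
  exists2 l, u @ \oo --> l & forall n, rnorm (l - u n) <= b n.
Proof.
move=> ub b0.
have /cvg_ex [l ul] : cvgn u.
  apply: (@cvg_cauchy_bound _ _ _ (fun n => (b n)%:C)).
    by move=> n m /ub; rewrite rnormE lecR.
  exact: realC_cvg0.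
exists l => // n; apply: (rnorm_cvg_le ul); exists n => m; exact: ub.
Qed.

Lemma rnorm_ReIm (z : R[i]) :
  [/\ `|complex.Re z| <= rnorm z, `|complex.Im z| <= rnorm z &
      rnorm z <= `|complex.Re z| + `|complex.Im z| ].
Proof.
rewrite /rnorm normc_def/=; split.
- by rewrite -sqrtr_sqr ler_wsqrtr// lerDl sqr_ge0.
- by rewrite -sqrtr_sqr ler_wsqrtr// lerDr sqr_ge0.
- rewrite -[leRHS]ger0_norm ?addr_ge0// -sqrtr_sqr ler_wsqrtr//.
  rewrite sqrrD !real_normK ?num_real// lerD2r lerDl.
  by rewrite mulrn_wge0// mulr_ge0.
Qed.

(** Real and imaginary parts obey the same Cauchy bound, so completeness of [R] suffices. *)
Lemma cvg_rcauchy_scalar (u : nat -> R[i]) (b : nat -> R) :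
  (forall n m, (n <= m)%N -> rnorm (u m - u n) <= b n) -> b @ \oo --> (0 : R) ->
  exists l : R[i], (u : nat -> R[i]^o) @ \oo --> (l : R[i]^o).
Proof.
move=> ub b0.
have /cvg_ex [x ux] : cvgn (fun n => complex.Re (u n)).
  apply: (@cvg_cauchy_bound _ (R^o) _ b) => // n m /ub; apply: le_trans.
  by rewrite -(raddfB (@complex.Re R)); have [] := rnorm_ReIm (u m - u n).
have /cvg_ex [y uy] : cvgn (fun n => complex.Im (u n)).
  apply: (@cvg_cauchy_bound _ (R^o) _ b) => // n m /ub; apply: le_trans.
  by rewrite -(raddfB (@complex.Im R)); have [] := rnorm_ReIm (u m - u n).
exists (x +i* y).
apply: (@cvg_rnorm_squeeze _ (R[i]^o) _ _
  (fun n => `|complex.Re (u n) - x| + `|complex.Im (u n) - y|)).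
  move=> n; have [_ _] := rnorm_ReIm (u n - (x +i* y)).
  by case: (u n).
rewrite -[0 in X in _ --> X]addr0.
have h (f : nat -> R) l : f @ \oo --> l -> (fun n => `|f n - l|) @ \oo --> (0:R).
  move=> fl; rewrite -(normr0 R) -[in X in _ --> X](subrr l).
  by apply: cvg_norm; apply: cvgB => //; exact: cvg_cst.
by apply: cvgD; exact: h.
Qed.

End Complete.


(** * Baire category *)

Section Covering.
Context {R : realType} {X : completeNormedModType R[i]}.

(** Otherwise each ball contains a smaller ball away from [A m], and nested balls shrinking to a
    point give a vector outside every [A m]. *)
Lemma baire_cover (A : nat -> set X) : (forall v, exists m, A m v) ->
  exists m v (r : R), 0 < r /\
    forall h, rnorm (h - v) < r -> forall e, 0 < e ->
      exists2 u, A m u & rnorm (h - u) < e.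
Proof.
move=> Acov; apply: contrapT => nA.
have step (m : nat) (p : X * R) : exists q : X * R, 0 < p.2 ->
  [/\ 0 < q.2, rnorm (q.1 - p.1) + q.2 <= p.2, q.2 <= p.2 / 2 &
      forall u, A m u -> q.2 < rnorm (q.1 - u)].
  case: p => v r /=; have [r0|r0] := ltP 0 r; last by exists (v, r).
  have : ~ (forall h, rnorm (h - v) < r -> forall e, 0 < e ->
      exists2 u, A m u & rnorm (h - u) < e).
    by move=> h; apply: nA; exists m, v, r.
  move=> /existsNP [h /not_implyP [hv /existsNP [e /not_implyP [e0 he]]]].
  have he' u : A m u -> e <= rnorm (h - u).
    by move=> Au; rewrite leNgt; apply/negP => lt; apply: he; exists u.
  (* The three bounds on [s] keep the new ball away from [A m], inside the old ball, and of at most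
     half its radius. *)
  pose s := Num.min (e / 2) (Num.min (r - rnorm (h - v)) (r / 2)).
  exists (h, s) => _ /=; split.
  - by rewrite /s !lt_min; apply/and3P; split; lra.
  - have : s <= r - rnorm (h - v) by rewrite /s !ge_min lexx orbT.
    lra.
  - by rewrite /s !ge_min lexx !orbT.
  - move=> u /he'; have : s <= e / 2 by rewrite /s !ge_min lexx.
    lra.
have [f fP] := choice (fun mp : nat * (X * R) => step mp.1 mp.2).
pose p := fix p n : X * R := if n is m.+1 then f (m, p m) else (0, 1).
have p0 n : 0 < (p n).2.
  by elim: n => [|n IH] //=; have [] := fP (n, p n) IH.
have pS n : [/\ rnorm ((p n.+1).1 - (p n).1) + (p n.+1).2 <= (p n).2,
    (p n.+1).2 <= (p n).2 / 2 &
    forall u, A n u -> (p n.+1).2 < rnorm ((p n.+1).1 - u)].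
  by have [] := fP (n, p n) (p0 n).
have pbound n m : (n <= m)%N -> rnorm ((p m).1 - (p n).1) + (p m).2 <= (p n).2.
  move=> /subnK <-; elim: (m - n)%N => [|k IH].
    by rewrite subrr rnorm0 add0r.
  have [h _ _] := pS (k + n)%N.
  have := rdistD (p (k.+1 + n)%N).1 (p (k + n)%N).1 (p n).1.
  rewrite addSn in h *; lra.
have phalf n : (p n).2 <= 1 * 2^-1 ^+ n.
  elim: n => [|n IH]; first by rewrite expr0 mulr1.
  by have [_ h _] := pS n; rewrite exprSr; lra.
have plim : (fun n => (p n).2) @ \oo --> (0 : R).
  apply: (squeeze_cvgr _ (cvg_cst _) (cvg_half_expr 1)).
  by apply: nearW => n; rewrite phalf ltW.
have [|l _ lb] := @cvg_rcauchy _ _ (fun n => (p n).1) _ _ plim.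
  by move=> n m /pbound; have := p0 m; lra.
(* The limit [l] lies in every ball of the sequence, whereas ball [m.+1] misses [A m]. *)
have [m Al] := Acov l; have [_ _ /(_ _ Al)] := pS m.
by rewrite rdistC; have := lb m.+1; lra.
Qed.

End Covering.

(** * Coefficient functionals and partial sums of a Schauder basis *)

Section Basis.
Context {R : realType} {X : completeNormedModType R[i]}.
Variables (x : nat -> X) (bx : schauder_basis x).
Local Notation C := R[i].

Definition coef (n : nat) (v : X) : C^o := projT1 (cid (bx v)) n.

Lemma coefP v : series (fun n => coef n v *: x n) @ \oo --> v.
Proof. by rewrite /coef; case: (cid _) => a []. Qed.

Lemma coef_unique v (a : nat -> C) :
  series (fun n => a n *: x n) @ \oo --> v -> forall n, coef n v = a n.
Proof.
move=> av n; rewrite /coef; case: (cid _) => b [bv /= b_uniq].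
by rewrite (b_uniq _ av).
Qed.

Lemma coef_is_linear n : linear (coef n).
Proof.
move=> c u v; apply: (@coef_unique _ (fun n => c *: coef n u + coef n v)).
rewrite (_ : series _ = fun N => c *: series (fun n => coef n u *: x n) N +
    series (fun n => coef n v *: x n) N).
  by apply: cvgD; [apply: cvgZl_tmp|]; exact: coefP.
apply/funext => N; rewrite /series/= scaler_sumr -big_split/=.
by apply: eq_bigr => k _; rewrite scalerDl scalerA.
Qed.

HB.instance Definition _ n :=
  GRing.isLinear.Build C X C^o *:%R (coef n) (coef_is_linear n).

Definition psum (N : nat) (v : X) : X := \sum_(0 <= n < N) coef n v *: x n.

Lemma psum_is_linear N : linear (psum N).
Proof.
move=> c u v; rewrite /psum scaler_sumr -big_split/=.
by apply: eq_bigr => k _; rewrite linearP scalerDl scalerA.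
Qed.

HB.instance Definition _ N :=
  GRing.isLinear.Build C X X *:%R (psum N) (psum_is_linear N).

Lemma psum_cvg v : psum ^~ v @ \oo --> v.
Proof. exact: coefP. Qed.

Lemma coef_basis n m : coef n (x m) = (n == m)%:R.
Proof.
apply: (@coef_unique _ (fun n => (n == m)%:R)).
apply/cvg_rnormP => e e0; exists m.+1 => N mN.
rewrite /series/= (big_cat_nat _ mN)//= big_nat_recr//= eqxx scale1r.
rewrite big_nat big1 ?add0r; last first.
  by move=> i /andP[_ im]; rewrite ltn_eqF// scale0r.
rewrite big_nat big1 ?addr0 ?subrr ?rnorm0// => i /andP[mi _].
by rewrite gtn_eqF// scale0r.
Qed.

Hypothesis nx : normalised x.

Lemma rnorm_basis n : rnorm (x n) = 1.
Proof. by rewrite /rnorm nx. Qed.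

(** [coef n v *: x n] is the difference of two consecutive partial sums, and [x n] has norm 1. *)
Lemma coef_le_psum n v (m : R) : (forall N, rnorm (psum N v) <= m) ->
  rnorm (coef n v) <= 2 * m.
Proof.
move=> hm.
have -> : rnorm (coef n v) = rnorm (psum n.+1 v - psum n v).
  rewrite /psum big_nat_recr//= addrAC subrr add0r.
  by rewrite rnormZ rnorm_basis mulr1.
have := rnormB (psum n.+1 v) (psum n v).
by have := hm n; have := hm n.+1; lra.
Qed.

(* The open mapping argument for the norm [sup_N `|psum N v|]: a ball of it is
   dense in some ball of [X] by Baire, so each [v] is a series of vectors with
   geometrically decreasing such norms; the limits [b] of the coefficients of
   its partial sums are the coefficients of [v]. *)
Lemma psum_bounded : exists2 K : R, 0 < K &
  forall v N, rnorm (psum N v) <= K * rnorm v.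
Proof.
have [v|m [v0 [r [r0 Hm]]]] :=
    @baire_cover _ X (fun m => [set v | forall N, rnorm (psum N v) <= m%:R]).
  (* The partial sums of [v] converge, hence are bounded: by [rnorm v + 1] from [N0] on, by the
     finite sum before. *)
  have /cvg_rnormP /(_ 1 ltr01) [N0 HN0] := @psum_cvg v.
  pose b := rnorm v + 1 + \sum_(0 <= i < N0) rnorm (psum i v).
  exists (Num.bound b) => N.
  have b0 : 0 <= b by rewrite !addr_ge0 ?rnorm_ge0// sumr_ge0// => *; rewrite rnorm_ge0.
  apply: le_trans (ltW (archi_boundP b0)); rewrite /b.
  have [NN0|NN0] := leqP N0 N.
    have := HN0 _ NN0; have := rnormD (psum N v - v) v; rewrite subrK.
    have : 0 <= \sum_(0 <= i < N0) rnorm (psum i v).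
      by rewrite sumr_ge0// => *; rewrite rnorm_ge0.
    lra.
  rewrite ler_wpDl ?addr_ge0 ?rnorm_ge0// (bigD1_seq N)/= ?iota_uniq//.
    by rewrite lerDl sumr_ge0// => *; rewrite rnorm_ge0.
  by rewrite mem_index_iota.
(* The approximant is a difference of two vectors with partial sums at most [m], rescaled by
   [t^-1 = 2 * rnorm v / r]. *)
pose K : R := 4 * m%:R / r.
have K0 : 0 <= K by rewrite divr_ge0 ?mulr_ge0// ltW.
have approx (p : X * R) : exists u, 0 < p.2 ->
    (forall N, rnorm (psum N u) <= K * rnorm p.1) /\ rnorm (p.1 - u) < p.2.
  case: p => v e /=.
  have [->|v_neq0] := eqVneq v 0.
    exists 0 => e0; rewrite subrr rnorm0 mulr0; split=> // N.
    by rewrite linear0 rnorm0.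
  have [e0|e0] := pselect (0 < e); last by exists 0 => /e0.
  have nv : 0 < rnorm v by rewrite rnorm_gt0.
  pose t := r / (2 * rnorm v).
  have t0 : 0 < t by rewrite divr_gt0// mulr_gt0.
  have ti0 : 0 <= t^-1 by rewrite invr_ge0 ltW.
  have te : 0 < t * e / 2 by rewrite divr_gt0// mulr_gt0.
  have [|u1 u1m u1e] := Hm (t%:C *: v + v0) _ _ te.
    rewrite addrK rnormZr ?ltW// /t invfM mulrA mulfVK ?gt_eqF//.
    by rewrite ltr_pdivrMr// ltr_pMr// ltr1n.
  have [|u2 u2m u2e] := Hm v0 _ _ te; first by rewrite subrr rnorm0.
  exists ((t^-1)%:C *: (u1 - u2)) => _; split=> [N|].
    rewrite linearZ/= linearB/= rnormZr//.
    rewrite ler_pdivrMl// (le_trans (rnormB _ _))//.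
    apply: le_trans (lerD (u1m N) (u2m N)) _.
    rewrite /K /t le_eqVlt; apply/orP; left; apply/eqP.
    by field; rewrite !gt_eqF.
  rewrite (_ : v - _ = (t^-1)%:C *: ((t%:C *: v + v0 - u1) - (v0 - u2))).
    rewrite rnormZr// ltr_pdivrMl//.
    by rewrite (le_lt_trans (rnormB _ _))// mulrC; lra.
  rewrite opprB (addrAC _ v0) -(addrA _ v0) (addrCA v0) subrr addr0 -addrA.
  rewrite [- u1 + _]addrC -(opprB u1) [RHS]scalerBr scalerA -rmorphM/=.
  by rewrite mulVf ?gt_eqF// scale1r.
have [f fP] := choice approx.
exists (2 * K + 1); first by lra.
move=> v; have [->|v_neq0] := eqVneq v 0.
  by move=> N; rewrite linear0 rnorm0 mulr0.
have nv : 0 < rnorm v by rewrite rnorm_gt0.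
pose e k := rnorm v * 2^-1 ^+ k.
have e0 k : 0 < e k by rewrite mulr_gt0// exprn_gt0// invr_gt0.
have e_ge0 k : 0 <= e k by exact/ltW.
(* [w k] is what remains of [v] after [k] successive approximations. *)
pose w := fix w k := if k is j.+1 then w j - f (w j, e j.+1) else v.
have we k : rnorm (w k) <= e k.
  case: k => [|k] /=; first by rewrite /e expr0 mulr1.
  by have [_ /ltW] := fP (w k, e k.+1) (e0 _).
have wS k N : rnorm (psum N (w k - w k.+1)) <= K * e k.
  rewrite /= opprB addrCA subrr addr0.
  have [/(_ N) h _] := fP (w k, e k.+1) (e0 _).
  by rewrite (le_trans h)//= ler_wpM2l// we.
have eS k : e k.+1 = e k / 2 by rewrite /e exprSr mulrA.
have wB k l N : (k <= l)%N -> rnorm (psum N (w k - w l)) <= 2 * K * e k.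
  move=> /subnK <-.
  (* Since [e] halves at each step, [K * e j = 2 * K * e j - 2 * K * e j.+1], and the geometric sum
     telescopes. *)
  suff : rnorm (psum N (w k - w (l - k + k)%N)) <=
      2 * K * e k - 2 * K * e (l - k + k)%N.
    move=> h; apply: (le_trans h); rewrite gerBl.
    by rewrite mulr_ge0 ?e_ge0// mulr_ge0.
  elim: (l - k)%N => [|j IH]; first by rewrite !subrr linear0 rnorm0.
  rewrite addSn -(subrKA (w (j + k)%N)) linearD.
  have := rnormD (psum N (w k - w (j + k)%N)) (psum N (w (j + k)%N - w (j + k).+1)).
  by have := wS (j + k)%N N; rewrite (eS (j + k)%N); lra.
have lim_e (c : R) : (fun k => c * e k) @ \oo --> (0 : R).
  by rewrite /e; under eq_fun do rewrite mulrA; exact: cvg_half_expr.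
have cb n : exists l : C^o, (fun k => coef n (w 0%N - w k)) @ \oo --> l.
  apply: (@cvg_rcauchy_scalar _ _ (fun k => 2 * (2 * K) * e k)) => // k l kl.
  rewrite -linearB opprB addrC subrKA -mulrA; apply: coef_le_psum => N.
  by rewrite wB.
have [b bP] := choice cb.
have sb N k : rnorm (\sum_(0 <= n < N) b n *: x n - psum N (w 0%N - w k)) <=
    2 * K * e k.
  apply: (@rnorm_cvg_le _ _ (fun l => psum N (w 0%N - w l))).
    apply: cvg_big => [|n _]; first exact: add_continuous.
    by apply: cvgZr_tmp; exact: bP.
  exists k => l kl; rewrite -linearB opprB addrC subrKA.
  exact: wB.
have bv : series (fun n => b n *: x n) @ \oo --> v.
  apply/cvg_rnormP => eps eps0.
  have /cvgrPdist_lt /(_ (eps / 2)) [|k _ /(_ k (leqnn _))] := lim_e (2 * K + 1).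
    by rewrite divr_gt0.
  rewrite sub0r normrN ger0_norm => [Hk|]; last by rewrite mulr_ge0 ?e_ge0//; lra.
  have /cvg_rnormP /(_ (eps / 2)) [|N0 HN0] := @psum_cvg (w 0%N - w k).
    by rewrite divr_gt0.
  exists N0 => N /HN0; have := sb N k; have := we k.
  rewrite /series; set s := (\sum_(0 <= _ < _) _); set t := psum N _ => h1 h2 h3.
  have := rdistD s t v; have := rdistD t (w 0%N - w k) v.
  have -> : w 0%N - w k - v = - w k by rewrite addrAC subrr add0r.
  by rewrite rnormN; lra.
move=> N.
(* This is the case [k = 0] of [sb], where the subtracted partial sum is 0. *)
have -> : psum N v = \sum_(0 <= n < N) b n *: x n - psum N (w 0%N - w 0%N).
  rewrite subrr linear0 subr0; apply: eq_bigr => n _.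
  by rewrite (coef_unique bv).
apply: le_trans (sb _ _) _.
by rewrite /e expr0 mulr1 ler_wpM2r ?rnorm_ge0// lerDl.
Qed.

End Basis.


(** * Bounded operators and series of rank one operators *)

Section Operators.
Context {R : realType} {X : completeNormedModType R[i]}.
Local Notation C := R[i].

Lemma coef_bounded (x : nat -> X) (bx : schauder_basis x) :
  normalised x -> exists2 M : R, 0 < M &
  forall n v, rnorm (coef bx n v : C) <= M * rnorm v.
Proof.
move=> nx; have [K K0 HK] := psum_bounded bx nx.
exists (2 * K) => [|n v]; first by rewrite mulr_gt0.
by rewrite -mulrA; apply: coef_le_psum => // N; exact: HK.
Qed.

Lemma linear_span_dense (x : nat -> X) (bx : schauder_basis x) (G : set X) :
  G 0 -> (forall c u v, G u -> G v -> G (c *: u + v)) -> (forall n, G (x n)) ->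
  forall v e, 0 < e -> exists2 z, G z & rnorm (z - v) < e.
Proof.
move=> G0 GD Gx v e /((cvg_rnormP _ _).1 (@psum_cvg _ _ _ bx v)) [N HN].
exists (psum bx N v); last exact: HN.
rewrite /psum; elim: N {HN} => [|N IH]; first by rewrite big_geq.
by rewrite big_nat_recr//= addrC; exact: GD.
Qed.

(** The geometric series dominates the sum by [2 * M * e]; pointwise convergence is recorded so that
    [P] can be evaluated on basis vectors. *)
Lemma sum_rank_one (phi : nat -> {linear X -> C^o}) (r : nat -> X) (M e : R) :
  0 <= M -> (forall j v, rnorm (phi j v : C) <= M * rnorm v) ->
  (forall j, rnorm (r j) <= e * 2^-1 ^+ j) ->
  exists2 P : {linear X -> X},
    (forall v, rnorm (P v) <= 2 * M * e * rnorm v) &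
    (forall v, (fun N => \sum_(0 <= j < N) phi j v *: r j) @ \oo --> P v).
Proof.
move=> M0 phiM re.
pose s N v := \sum_(0 <= j < N) phi j v *: r j.
have sB v n m : (n <= m)%N ->
    rnorm (s m v - s n v) <= 2 * M * e * rnorm v * 2^-1 ^+ n.
  have e0 : 0 <= e.
    by have := re 0%N; rewrite expr0 mulr1; apply: le_trans; rewrite rnorm_ge0.
  have B0 : 0 <= 2 * M * e * rnorm v by rewrite !mulr_ge0// rnorm_ge0.
  move=> /subnK <-.
  suff : rnorm (s (m - n + n)%N v - s n v) <=
      2 * M * e * rnorm v * (2^-1 ^+ n - 2^-1 ^+ (m - n + n)).
    move=> h; apply: (le_trans h); rewrite ler_wpM2l// gerBl.
    by rewrite exprn_ge0// invr_ge0.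
  elim: (m - n)%N => [|j IH]; first by rewrite !subrr rnorm0 mulr0.
  rewrite addSn exprSr {1}/s big_nat_recr//= -/(s (j + n)%N v) addrAC.
  have := rnormD (s (j + n)%N v - s n v) (phi (j + n)%N v *: r (j + n)%N).
  rewrite rnormZ; have := ler_pM (rnorm_ge0 _) (rnorm_ge0 _) (phiM (j + n)%N v) (re (j + n)%N).
  lra.
have sC v : exists y, s ^~ v @ \oo --> y /\ rnorm y <= 2 * M * e * rnorm v.
  have [y sy yb] := cvg_rcauchy (sB v) (cvg_half_expr _).
  exists y; split=> //; have := yb 0%N.
  by rewrite /s big_geq// subr0 expr0 mulr1.
have [P PP] := choice sC.
have linP : linear P.
  move=> c u v; have [h _] := PP (c *: u + v).
  apply: (cvg_unique _ h) => //.
  have -> : s ^~ (c *: u + v) = fun N => c *: s N u + s N v.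
    apply/funext => N; rewrite /s scaler_sumr -big_split/=.
    by apply: eq_bigr => k _; rewrite linearP scalerDl scalerA.
  apply: cvgD; last by have [] := PP v.
  by apply: cvgZl_tmp; have [] := PP u.
pose Pl : {linear X -> X} := HB.pack P (GRing.isLinear.Build _ _ _ _ P linP).
by exists Pl => v; have [] := PP v.
Qed.

Lemma boundedE (T : {linear X -> X}) : bounded_operator T <->
  exists2 M : R, 0 < M & forall v, rnorm (T v) <= M * rnorm v.
Proof.
split=> [/linear_boundedP [M [Mreal HM]]|[M M0 HM]].
  pose M' : R := `|complex.Re M| + 1.
  have MM' : M < M'%:C.
    rewrite -(RRe_real Mreal) ltcR /M' (le_lt_trans (ler_norm _))//.
    by rewrite ltrDl.
  exists M' => [|v]; first by rewrite ltr_wpDl.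
  by have := HM _ MM' v; rewrite !rnormE -rmorphM lecR.
apply/linear_boundedP; exists M%:C; split; first by rewrite complex_real.
move=> r Mr v; rewrite rnormE.
have -> : r = (complex.Re r)%:C.
  by rewrite RRe_real// (@gtr0_real _ r)// (lt_trans _ Mr)// ltcR.
rewrite rnormE -rmorphM lecR (le_trans (HM v))// ler_wpM2r ?rnorm_ge0//.
by move: Mr; rewrite ltcE/= => /andP[_ /ltW].
Qed.

Lemma opnorm_le (T : {linear X -> X}) (M : R) : 0 <= M ->
  (forall v, rnorm (T v) <= M * rnorm v) -> opnorm T <= M.
Proof.
move=> M0 TM; apply: sup_le_ub.
  by exists (rnorm (T 0)), 0 => //=; rewrite normr0.
move=> _ [v /= v1 <-]; apply: (le_trans (TM v)).
by rewrite ler_piMr// -lecR -rnormE.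
Qed.

End Operators.


(** * A criterion for mixing *)

Section MixingCriterion.
Context {R : realType} {X : completeNormedModType R[i]}.
Local Notation C := R[i].
Variable T : {linear X -> X}.

Lemma iter_linearP k c u v :
  iter k T (c *: u + v) = c *: iter k T u + iter k T v.
Proof. by elim: k => //= k ->; rewrite linearP. Qed.

Lemma iter_linearZ k c u : iter k T (c *: u) = c *: iter k T u.
Proof. by elim: k => //= k ->; rewrite linearZ. Qed.

Lemma iter_linear0 k : iter k T 0 = 0.
Proof. by elim: k => //= k ->; rewrite linear0. Qed.

(** A form of Kitai's criterion for a single vector: orbits from near [z] come close to 0, orbits
    from near 0 come close to [z], with starting points depending on the time [k]. *)
Definition mixing_vector (z : X) :=
  (exists2 u : nat -> X, u @ \oo --> z &
     (fun k => iter k T (u k)) @ \oo --> (0 : X)) /\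
  (exists2 p : nat -> X, p @ \oo --> (0 : X) &
     (fun k => iter k T (p k)) @ \oo --> z).

Lemma mixing_vector0 : mixing_vector 0.
Proof.
have h : (fun k => iter k T ((fun=> 0) k)) @ \oo --> (0 : X).
  by under eq_fun do rewrite iter_linear0; exact: cvg_cst.
by split; exists (fun=> 0) => //; exact: cvg_cst.
Qed.

Lemma mixing_vectorP c z1 z2 :
  mixing_vector z1 -> mixing_vector z2 -> mixing_vector (c *: z1 + z2).
Proof.
move=> [[u1 u1z Tu1] [p1 p10 Tp1]] [[u2 u2z Tu2] [p2 p20 Tp2]].
have lim (s1 s2 : nat -> X) l1 l2 : s1 @ \oo --> l1 -> s2 @ \oo --> l2 ->
    (fun k => c *: s1 k + s2 k) @ \oo --> c *: l1 + l2.
  by move=> h1 h2; apply: cvgD => //; apply: cvgZl_tmp.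
have z0 : c *: 0 + 0 = 0 :> X by rewrite scaler0 addr0.
split.
- exists (fun k => c *: u1 k + u2 k); first exact: lim.
  by rewrite -z0; under eq_fun do rewrite iter_linearP; exact: lim.
- exists (fun k => c *: p1 k + p2 k); first by rewrite -z0; exact: lim.
  by under eq_fun do rewrite iter_linearP; exact: lim.
Qed.

Lemma open_rball (U : set X) v : open U -> U v ->
  exists2 e : R, 0 < e & forall w, rnorm (w - v) < e -> U w.
Proof.
move=> oU Uv; have /nbhs_ballP [e /= e0 He] : nbhs v U by exact: open_nbhs_nbhs.
have er : e = (complex.Re e)%:C by rewrite RRe_real// gtr0_real.
exists (complex.Re e); first by move: e0; rewrite er ltcR.
move=> w wv; apply: He; rewrite -ball_normE /ball_/= er.
by rewrite rnormE ltcR rdistC.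
Qed.

(** The vector [x k + p k] starts near [u] in [U] and after [k] steps is near [v] in [V]. *)
Lemma mixing_of_dense :
  (forall v e, 0 < e -> exists2 z, mixing_vector z & rnorm (z - v) < e) ->
  mixing T.
Proof.
move=> dT U V oU [u0 Uu0] oV [v0 Vv0].
have [e e0 HU] := open_rball oU Uu0.
have [e' e'0 HV] := open_rball oV Vv0.
have [u [[x xu Tx] _] ue] := dT u0 (e / 2) (divr_gt0 e0 (ltr0n _ 2)).
have [v [_ [p p0 Tp]] ve] := dT v0 (e' / 2) (divr_gt0 e'0 (ltr0n _ 2)).
have : (fun k => x k + p k) @ \oo --> u + 0 by exact: cvgD.
move=> /cvg_rnormP /(_ (e / 2)) [|N1 HN1]; first by rewrite divr_gt0.
have : (fun k => iter k T (x k) + iter k T (p k)) @ \oo --> 0 + v by exact: cvgD.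
move=> /cvg_rnormP /(_ (e' / 2)) [|N2 HN2]; first by rewrite divr_gt0.
exists (maxn N1 N2) => k; rewrite gtn_max => /andP[/ltnW k1 /ltnW k2].
exists (iter k T (x k + p k)); split.
  exists (x k + p k) => //; apply: HU.
  have := HN1 _ k1; have := rdistD (x k + p k) u u0; rewrite addr0; lra.
apply: HV; have := HN2 _ k2; rewrite add0r.
have := iter_linearP k 1 (x k) (p k); rewrite !scale1r => <-.
have := rdistD (iter k T (x k + p k)) v v0; lra.
Qed.

End MixingCriterion.

(** * Finite differences *)

Section Differences.
Context {F : comNzRingType}.
Implicit Types f g : nat -> F.

(** Below, [iter n fdiff f = (fun=> 0)] plays the role of [f] being a polynomial of degree less than
    [n]. *)
Definition fdiff f : nat -> F := fun s => f s.+1 - f s.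

Lemma iter_fdiff0 n : iter n fdiff (fun=> 0) = fun=> 0.
Proof. by elim: n => //= n ->; apply/funext => s; rewrite /fdiff subrr. Qed.

Lemma iter_fdiffP n b f g :
  iter n fdiff (fun s => g s + b * f s) =
  fun s => iter n fdiff g s + b * iter n fdiff f s.
Proof. by elim: n => //= n ->; apply/funext => s; rewrite /fdiff; ring. Qed.

(** By the discrete product rule, a linear factor raises the degree by at most one. *)
Lemma iter_fdiffM n f a b : iter n fdiff f = (fun=> 0) ->
  iter n.+1 fdiff (fun s => f s * (a + b * s%:R)) = fun=> 0.
Proof.
elim: n f a => [|n IH] f a f0.
  by rewrite /= [f]f0; apply/funext => s; rewrite /fdiff !mul0r subrr.
rewrite iterSr.
have -> : fdiff (fun s => f s * (a + b * s%:R)) =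
    fun s => fdiff f s * (a + b + b * s%:R) + b * f s.
  by apply/funext => s; rewrite /fdiff -natr1; ring.
rewrite (iter_fdiffP _ b) IH -?iterSr// f0.
by apply/funext => s; rewrite mulr0 addr0.
Qed.

Lemma iter_fdiff_prod n a :
  iter n.+1 fdiff (fun s => \prod_(i < n) (s%:R - a - i%:R)) = fun=> 0.
Proof.
elim: n => [|n IH]; first by apply/funext => s; rewrite /= /fdiff !big_ord0 subrr.
rewrite -[RHS](iter_fdiffM (- a - n%:R) 1 IH); congr (iter _ _ _).
by apply/funext => s; rewrite big_ord_recr/=; congr (_ * _); ring.
Qed.

Lemma iter_fdiffX n m f a b : iter n fdiff f = (fun=> 0) ->
  iter (n + m) fdiff (fun s => f s * (a + b * s%:R) ^+ m) = fun=> 0.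
Proof.
move=> f0; elim: m => [|m IH].
  by rewrite addn0 -[RHS]f0; congr (iter _ _ _); apply/funext => s; rewrite mulr1.
rewrite addnS -[RHS](iter_fdiffM a b IH); congr (iter _ _ _).
by apply/funext => s; rewrite exprSr mulrA.
Qed.

Lemma prod_ffact d s : \prod_(i < d) (s%:R - i%:R) = (s ^_ d)%:R :> F.
Proof.
elim: d => [|d IH]; first by rewrite big_ord0 ffactn0.
rewrite big_ord_recr/= IH ffactnSr natrM.
have [ds|sd] := leqP d s; first by rewrite natrB.
by rewrite ffact_small// !mul0r.
Qed.

Lemma iter_fdiff_bin i d :
  iter i fdiff (fun s => 'C(s, d)%:R) 0%N = (i == d)%:R :> F.
Proof.
elim: i d => [|i IH] [|d] //; rewrite ?bin0 ?bin0n// iterSr.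
  rewrite (_ : fdiff _ = fun=> 0) ?iter_fdiff0//.
  by apply/funext => s; rewrite /fdiff !bin0 subrr.
rewrite eqSS -IH; congr (iter _ _ _ _).
by apply/funext => s; rewrite /fdiff binS natrD addrAC subrr add0r.
Qed.

End Differences.

(** * Jordan chains and jets of polynomials *)

Section Chain.
Context {R : realType} {X : completeNormedModType R[i]}.
Local Notation C := R[i].
Variables (T : {linear X -> X}) (lam : C) (e : nat -> X).
Hypothesis lam1 : `|lam| = 1.
Hypothesis Te0 : T (e 0%N) = lam *: e 0%N.
Hypothesis TeS : forall i, T (e i.+1) = lam *: e i.+1 + e i.

(* When [f] is a polynomial of degree less than [M], [T] acts on [jet M f] as
   [lam] times the translation of [f]. *)
Definition jet (M : nat) (f : nat -> C) (s : nat) : X :=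
  \sum_(i < M) (lam ^+ i * iter i fdiff f s) *: e i.

(** The identity [f s.+1 = f s + fdiff f s] mirrors [TeS]; only a term with the difference of order
    [M] is left over, and it vanishes. *)
Lemma T_jet M f s : iter M fdiff f = (fun=> 0) ->
  T (jet M f s) = lam *: jet M f s.+1.
Proof.
pose e' i := if i is j.+1 then e j else 0.
have Te i : T (e i) = lam *: e i + e' i.
  by case: i => [|i]; rewrite ?TeS// Te0 addr0.
have key : T (jet M f s) =
    lam *: jet M f s.+1 - (lam ^+ M * iter M fdiff f s) *: e' M.
  rewrite /jet; elim: M => [|M IH].
    by rewrite !big_ord0 linear0 !scaler0 subr0.
  rewrite !big_ord_recr/= linearD IH [T (_ *: _)]linearZ/= Te !scalerDr !scalerA.
  rewrite -addrA -[RHS]addrA; congr (_ + _).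
  rewrite addrCA addNr addr0 -scalerBl; congr (_ *: _).
  by rewrite /fdiff exprS; ring.
by move=> f0; rewrite key f0 mulr0 scale0r subr0.
Qed.

Lemma iter_T_jet M f k : iter M fdiff f = (fun=> 0) ->
  iter k T (jet M f 0%N) = lam ^+ k *: jet M f k.
Proof.
move=> f0; elim: k => [|k IH]; first by rewrite scale1r.
by rewrite iterS IH linearZ/= T_jet// scalerA exprSr.
Qed.

(** A jet involves finitely many values of the function, so pointwise convergence suffices, even
    when the base point [a k] moves. *)
Lemma jet_cvg M (f : nat -> nat -> C) (a : nat -> nat) (g : nat -> C) :
  (forall j, (fun k => f k (a k + j)%N : C^o) @ \oo --> (g j : C^o)) ->
  (fun k => jet M (f k) (a k)) @ \oo --> jet M g 0%N.
Proof.
move=> fg.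
have h i j : (fun k => iter i fdiff (f k) (a k + j)%N : C^o) @ \oo -->
    (iter i fdiff g j : C^o).
  elim: i j => [|i IH] j //=; rewrite /fdiff.
  by apply: cvgB; [have := IH j.+1; under eq_fun do rewrite addnS|exact: IH].
apply: cvg_big => [|i _]; first exact: add_continuous.
apply: cvgZr_tmp; apply: cvgM; first exact: cvg_cst.
by have := h i 0%N; under eq_fun do rewrite addn0.
Qed.

(** Of the differences at 0 of the falling factorial of degree [d], only that of order [d] is
    nonzero. *)
Lemma jet_ffact M d : (d < M)%N ->
  jet M (fun s => \prod_(i < d) (s%:R - i%:R)) 0%N = (d`!%:R * lam ^+ d) *: e d.
Proof.
move=> dM; rewrite /jet (bigD1 (Ordinal dM))//= big1 ?addr0.
all: have -> : (fun s => \prod_(i < d) (s%:R - i%:R) : C) =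
    (fun s => 0 + d`!%:R * 'C(s, d)%:R).
1,3: by apply/funext => s; rewrite prod_ffact add0r -natrM mulnC bin_ffact.
- by rewrite iter_fdiffP iter_fdiff_bin iter_fdiff0 eqxx mulr1 add0r mulrC.
- move=> i; rewrite -val_eqE/= => id.
  by rewrite iter_fdiffP iter_fdiff_bin iter_fdiff0 (negbTE id) mulr0 addr0 mulr0 scale0r.
Qed.

Lemma harmonicC_cvg : (fun k => k.+1%:R^-1 : C^o) @ \oo --> (0 : C^o).
Proof.
rewrite (_ : (fun k => _) = fun k => (harmonic k : R)%:C).
  by apply: realC_cvg0; exact: cvg_harmonic.
by apply/funext => k; rewrite /harmonic /= fmorphV/= rmorph_nat.
Qed.

Lemma cvg_prod_ord d (u : nat -> nat -> C) (l : C) :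
  (forall i, (u ^~ i : nat -> C^o) @ \oo --> (l : C^o)) ->
  (fun k => \prod_(i < d) u k i : C^o) @ \oo --> (l ^+ d : C^o).
Proof.
move=> ul; elim: d => [|d IH].
  by under eq_fun do rewrite big_ord0; exact: cvg_cst.
under eq_fun do rewrite big_ord_recr/=.
by rewrite exprSr; exact: (cvgM IH (ul d)).
Qed.

Lemma mixing_vector_chain d : mixing_vector T (e d).
Proof.
(* The polynomials [f] have degree at most [d + d.+1], which is less than [M]. *)
pose M := (d.+1 + d.+1)%N.
pose f (a b c : C) (s : nat) : C :=
  \prod_(i < d) (s%:R - a - i%:R) * (b + c * s%:R) ^+ d.+1.
have f0 a b c : iter M fdiff (f a b c) = fun=> 0.
  by apply: iter_fdiffX; exact: iter_fdiff_prod.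
(* Each of the [d] factors that may grow like [k] is paired with one of order [1 / k]; the remaining
   factor forces the limit 0. *)
have fE a b c s : f a b c s =
    \prod_(i < d) ((s%:R - a - i%:R) * (b + c * s%:R)) * (b + c * s%:R).
  by rewrite big_split/= prodr_const card_ord /f exprSr mulrA.
pose g (s : nat) : C := \prod_(i < d) (s%:R - i%:R).
have lin (a b : C) : (fun k => a + b * k.+1%:R^-1 : C^o) @ \oo --> (a : C^o).
  rewrite -[X in _ --> X]addr0 -[X in _ --> _ + X](mulr0 b).
  apply: cvgD; first exact: cvg_cst.
  by apply: cvgM; [exact: cvg_cst|exact: harmonicC_cvg].
have prod0 (u : nat -> nat -> C) (v : nat -> C) (l : C) :
    (forall i, (u ^~ i : nat -> C^o) @ \oo --> (l : C^o)) ->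
    (v : nat -> C^o) @ \oo --> (0 : C^o) ->
    (fun k => \prod_(i < d) u k i * v k : C^o) @ \oo --> (0 : C^o).
  by move=> ul v0; have := cvgM (@cvg_prod_ord d _ _ ul) v0; rewrite mulr0; exact.
have powX (v : nat -> C) (l : C) : (v : nat -> C^o) @ \oo --> (l : C^o) ->
    (fun k => v k ^+ d.+1 : C^o) @ \oo --> (l ^+ d.+1 : C^o).
  move=> vl; have := @cvg_prod_ord d.+1 (fun k _ => v k) l (fun=> vl).
  by under eq_fun do rewrite prodr_const card_ord.
have lamX k : lam ^+ k != 0.
  by rewrite expf_neq0// -normr_eq0 lam1 oner_eq0.
have rlam k : rnorm (lam ^+ k) = 1.
  by rewrite rnormX /rnorm lam1 expr1n.
have nz (k : nat) : k.+1%:R != 0 :> C by rewrite pnatr_eq0.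
have jet0 m : jet m (fun=> 0) 0%N = 0.
  by rewrite /jet big1// => i _; rewrite iter_fdiff0 mulr0 scale0r.
have rot0 (u : nat -> X) (s : nat -> C) : (forall k, rnorm (s k) = 1) ->
    u @ \oo --> (0 : X) -> (fun k => s k *: u k) @ \oo --> (0 : X).
  move=> s1 /cvg_rnorm0 u0; apply/cvg_rnorm0.
  by under eq_fun => k do rewrite subr0 rnormZ s1 mul1r -[u k]subr0.
suff : mixing_vector T (jet M g 0%N).
  rewrite jet_ffact ?leq_addr// => /(mixing_vectorP (d`!%:R * lam ^+ d)^-1).
  move=> /(_ _ (mixing_vector0 T)).
  by rewrite addr0 scalerA mulVf ?scale1r// mulf_neq0// pnatr_eq0 -lt0n fact_gt0.
split.
(* [g s * (1 - s / k) ^+ d.+1] is close to [g] near [0] and to [0] near [k];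
   below, [g (s - k) * (s / k) ^+ d.+1] does the converse. *)
- pose h k := f 0 1 (- k%:R^-1).
  exists (fun k => jet M (h k) 0%N).
    (* The index shift avoids the inverse of 0 at [k = 0]. *)
    apply: jet_cvg => j; rewrite -cvg_shiftS.
    have -> : g j = g j * 1 ^+ d.+1 by rewrite expr1n mulr1.
    rewrite /h /f /= add0n.
    apply: cvgM.
      by under eq_fun do under eq_bigr do rewrite subr0; exact: cvg_cst.
    apply: powX.
    by under eq_fun do rewrite mulNr mulrC -mulNr; exact: lin.
  under eq_fun => k do rewrite (iter_T_jet _ (f0 _ _ _)).
  apply: rot0 => //; rewrite -(jet0 M).
  apply: jet_cvg => j; rewrite -cvg_shiftS.
  under eq_fun do rewrite /h fE.
  apply: (@prod0 (fun k i => ((k.+1 + j)%:R - 0 - i%:R) *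
      (1 + - k.+1%:R^-1 * (k.+1 + j)%:R)) _ (- j%:R)) => [i|].
    rewrite (_ : (fun k => _) = fun k =>
      - j%:R + (- j%:R * (j%:R - i%:R)) * k.+1%:R^-1); first exact: lin.
    by apply/funext => k; rewrite natrD; field; rewrite nat1r nz.
  rewrite (_ : (fun k => _) = fun k => 0 + (- j%:R) * k.+1%:R^-1); first exact: lin.
  by apply/funext => k; rewrite natrD; field; rewrite nat1r nz.
- pose h (k : nat) := f k%:R 0 k%:R^-1.
  (* The factor [lam ^- k] cancels the [lam ^+ k] picked up along the orbit. *)
  exists (fun k => lam ^- k *: jet M (h k) 0%N).
    apply: rot0 => [k|]; first by rewrite rnormV rlam invr1.
    rewrite -(jet0 M); apply: jet_cvg => j; rewrite -cvg_shiftS.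
    under eq_fun do rewrite /h fE.
    apply: (@prod0 (fun k i => ((0 + j)%:R - k.+1%:R - i%:R) *
      (0 + k.+1%:R^-1 * (0 + j)%:R)) _ (- j%:R)) => [i|].
      rewrite (_ : (fun k => _) = fun k =>
        - j%:R + (j%:R * (j%:R - i%:R)) * k.+1%:R^-1); first exact: lin.
      by apply/funext => k; rewrite add0n; field; rewrite nat1r nz.
    rewrite (_ : (fun k => _) = fun k => 0 + j%:R * k.+1%:R^-1); first exact: lin.
    by apply/funext => k; rewrite add0n; field; rewrite nat1r nz.
  under eq_fun => k do rewrite iter_linearZ (iter_T_jet _ (f0 _ _ _)) scalerA mulVf// scale1r.
  apply: jet_cvg => j; rewrite -cvg_shiftS.
  have -> : g j = g j * 1 ^+ d.+1 by rewrite expr1n mulr1.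
  rewrite /h /f.
  apply: cvgM.
    under eq_fun do under eq_bigr do rewrite natrD (addrC _ j%:R) addrK.
    exact: cvg_cst.
  apply: powX.
  rewrite (_ : (fun k => _) = fun k => 1 + j%:R * k.+1%:R^-1); first exact: lin.
  by apply/funext => k; rewrite natrD; field; rewrite nat1r nz.
Qed.

End Chain.


(** * Rerouting a shift into a mixing operator *)

Section Paths.
Context {R : realType} {X : completeNormedModType R[i]}.
Local Notation C := R[i].

Lemma mixing_of_paths (x : nat -> X) (lam : C) (L : {linear X -> X}) :
  schauder_basis x -> `|lam| = 1 ->
  (forall k, exists k' mu, mu != 0 /\ L (x k') = mu *: x k) ->
  (forall k, exists p, iter p L (x k) = 0) ->
  mixing (((lam \*: idfun) \+ L) : {linear X -> X}).
Proof.
move=> bx lam1 pre nil; apply: mixing_of_dense.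
apply: (linear_span_dense bx); first exact: mixing_vector0.
  by move=> c u v; exact: mixing_vectorP.
move=> k; have [p Lp] := nil k.
have step (q : nat * C) : exists q' : nat * C, q.2 != 0 ->
    q'.2 != 0 /\ L (q'.2 *: x q'.1) = q.2 *: x q.1.
  have [k' [mu [mu0 Lk']]] := pre q.1.
  exists (k', q.2 / mu) => q0; split; first by rewrite mulf_neq0 ?invr_neq0.
  by rewrite linearZ/= Lk' scalerA divfK.
have [f fP] := choice step.
(* A backward path from [x k], with the scalars absorbed so that [L] takes each vector exactly to
   the previous one. *)
pose q := fix q n := if n is m.+1 then f (q m) else (k, 1 : C).
have q0 n : (q n).2 != 0.
  by elim: n => [|n IH] /=; [exact: oner_neq0 | have [] := fP _ IH].
pose g n := (q n).2 *: x (q n).1.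
have gS n : L (g n.+1) = g n by have [] := fP _ (q0 n).
have gp n : iter n L (g n) = x k.
  by elim: n => [|n IH]; [rewrite /g/= scale1r | rewrite iterSr gS].
(* Applying [L] [p] times moves the path forward, so that the chain starts at 0 and has [x k] in
   position [p]. *)
rewrite -(gp p); apply: (@mixing_vector_chain _ _ _ lam (fun n => iter p L (g n))) => //=.
- by rewrite -iterS iterSr /g/= scale1r -iterSr iterS Lp linear0 addr0.
- by move=> n; rewrite -iterS iterSr gS.
Qed.

(** By biorthogonality and injectivity of [kap], at most one term of the series survives at a basis
    vector. *)
Lemma coef_series_basis (x : nat -> X) (bx : schauder_basis x) (kap : nat -> nat)
    (r : nat -> X) (P : X -> X) : injective kap ->
  (forall v, (fun N => \sum_(0 <= j < N) coef bx (kap j) v *: r j) @ \oo --> P v) ->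
  (forall j, P (x (kap j)) = r j) /\
  (forall k, (forall j, kap j != k) -> P (x k) = 0).
Proof.
move=> kapI HP; split=> [j|k kj]; apply: (cvg_unique _ (HP _)) => //.
- apply/cvg_rnormP => e e0; exists j.+1 => N jN.
  rewrite (big_cat_nat _ jN)//= big_nat_recr//= coef_basis eqxx scale1r.
  rewrite big_nat big1 ?add0r; last first.
    by move=> i /andP[_ ij]; rewrite coef_basis (inj_eq kapI) ltn_eqF// scale0r.
  rewrite big_nat big1 ?addr0 ?subrr ?rnorm0// => i /andP[ji _].
  by rewrite coef_basis (inj_eq kapI) gtn_eqF// scale0r.
- rewrite (_ : (fun N => _) = fun=> 0); first exact: cvg_cst.
  apply/funext => N; rewrite big1// => i _.
  by rewrite coef_basis (negbTE (kj i)) scale0r.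
Qed.

(* Both kinds of shift at once: the basis is indexed by the range of [e], which
   is either all integers or the nonnegative ones. *)
Lemma shift_mixing_closure (e : nat -> int) (y : int -> X) (w : int -> C)
    (lam : C) (S : {linear X -> X}) :
  injective e -> (exists k, e k = 0) ->
  (forall k, exists k', e k' = e k + 1) ->
  (forall k, e k = 0 \/ exists k', e k' = e k - 1) ->
  normalised y -> schauder_basis (y \o e) -> bounded_operator S ->
  (forall k, S (y (e k)) = w (e k) *: y (e k + 1)) ->
  (forall (eps : R) (N : int), 0 < eps ->
     exists k, N <= e k /\ rnorm (w (e k)) < eps) ->
  `|lam| = 1 ->
  opnorm_closure [set T | mixing T] (((lam \*: idfun) \+ S) : {linear X -> X}).
Proof.
move=> eI [k0 ek0] eS eP ny bx bS Sy wlim lam1.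
have rlam : rnorm lam = 1 by rewrite /rnorm lam1.
have ry n : rnorm (y n) = 1 by rewrite /rnorm ny.
have [M M0 HM] : exists2 M : R, 0 < M &
    forall n v, rnorm (coef bx n v : C) <= M * rnorm v.
  by apply: coef_bounded => k; exact: ny.
have [MS MS0 HMS] := (boundedE _).1 bS.
split.
  apply/boundedE; exists (1 + MS) => [|v]; first by rewrite addr_gt0.
  rewrite /= (le_trans (rnormD _ _))// rnormZ rlam mulrDl lerD2l.
  exact: HMS.
move=> eps eps0.
(* The norms of [P1] and [P2] will be at most [4 * M * d] and [2 * M * d], together [eps / 2]. *)
pose d : R := eps / (12 * M).
have d0 : 0 < d by rewrite divr_gt0// mulr_gt0.
pose dj j : R := d * 2^-1 ^+ j.
have dj0 j : 0 < dj j by rewrite mulr_gt0// exprn_gt0// invr_gt0.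
have dj_ge0 j : 0 <= dj j by exact/ltW.
have djC j : (dj j)%:C != 0 by rewrite -rnorm_gt0 rnorm_real normr_gt0 gt_eqF.
have step (p : nat * int) : exists k, p.2 <= e k /\ rnorm (w (e k)) < dj p.1.
  exact: wlim.
have [f fP] := choice step.
pose kap := fix kap j := if j is i.+1 then f (j, e (kap i) + 1) else f (0%N, 0).
have kap0 : 0 <= e (kap 0%N) by have [] := fP (0%N, 0).
have kapS j : e (kap j) + 1 <= e (kap j.+1) by have [] := fP (j.+1, e (kap j) + 1).
have wkap j : rnorm (w (e (kap j))) <= dj j.
  by case: j => [|j]; apply: ltW; [have [] := fP (0%N, 0)
    | have [] := fP (j.+1, e (kap j) + 1)].
have kap_lt i j : (i < j)%N -> e (kap i) < e (kap j).
  elim: j => // j IH; rewrite ltnS leq_eqVlt => /predU1P[->|/IH].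
    by have := kapS j; lia.
  by have := kapS j; lia.
have kap_ge j : j%:Z <= e (kap j).
  by elim: j => [|j IH] //; have := kapS j; lia.
have kapI : injective kap.
  by move=> i j ij; case: (ltngtP i j) => // /kap_lt; rewrite ij ltxx.
(* A path entering just after cut [j] runs to cut [j.+1] and jumps to just after cut [j.-1], so the
   cut index drops until cut 0 ends the path. Cut 1 supplies a preimage of [y 0], which has no
   predecessor in a one-sided basis. *)
pose tgt j := match j with
  | 0 => 0 | 1 => y 0 | i.+2 => y (e (kap i) + 1) end.
have tgt1 j : rnorm (tgt j) <= 1 by case: j => [|[|j]] /=; rewrite ?rnorm0 ?ry.
pose r1 j := (dj j)%:C *: tgt j - w (e (kap j)) *: y (e (kap j) + 1).
have r1e j : rnorm (r1 j) <= (2 * d) * 2^-1 ^+ j.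
  rewrite (le_trans (rnormB _ _))// rnormZr// rnormZ ry mulr1.
  by rewrite -mulrA mulr_natl mulr2n lerD// ler_piMr.
pose cut k := `[< exists j, kap j = k >].
pose r2 k := if (w (e k) == 0) && ~~ cut k then (dj k)%:C *: y (e k + 1) else 0.
have r2e j : rnorm (r2 j) <= d * 2^-1 ^+ j.
  rewrite /r2; case: ifP => _; last by rewrite rnorm0 dj_ge0.
  by rewrite rnormZr// ry mulr1.
(* [P1] cuts and reroutes the chains, [P2] makes vanishing weights nonzero. *)
have [P1 P1b P1c] := sum_rank_one (ltW M0)
  (fun j => HM (kap j) : forall v, rnorm ((coef bx (kap j) : {linear X -> C^o}) v : C) <= _) r1e.
have [P2 P2b P2c] := sum_rank_one (ltW M0)
  (fun j => HM j : forall v, rnorm ((coef bx j : {linear X -> C^o}) v : C) <= _) r2e.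
have [P1k P1n] := coef_series_basis kapI P1c.
have [P2k _] := @coef_series_basis _ bx id _ _ (@inj_id _) P2c.
pose L : {linear X -> X} := (S \+ P1) \+ P2.
have Lcut j : L (y (e (kap j))) = (dj j)%:C *: tgt j.
  rewrite /L/= Sy (P1k j) (P2k (kap j)) /r1 /r2.
  have -> : cut (kap j) by apply/asboolP; exists j.
  by rewrite andbF addr0 addrC subrK.
have Lnocut k : ~~ cut k -> exists2 mu, mu != 0 & L (y (e k)) = mu *: y (e k + 1).
  move=> kc; rewrite /L/= Sy (P1n k); last first.
    by move=> j; apply/eqP => jk; move/asboolP: kc; apply; exists j.
  rewrite (P2k k) addr0 /r2 kc andbT.
  have [->|wk] := eqVneq (w (e k)) 0; last by exists (w (e k)); rewrite ?addr0.
  by exists (dj k)%:C; rewrite ?djC// scale0r add0r.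
exists (((lam \*: idfun) \+ L) : {linear X -> X}); split.
- apply/boundedE; exists (1 + MS + 2 * M * (2 * d) + 2 * M * d) => [|v].
    by have Md0 : 0 < M * d := mulr_gt0 M0 d0; lra.
  have := rnormD (lam *: v) (S v + P1 v + P2 v).
  have := rnormD (S v + P1 v) (P2 v); have := rnormD (S v) (P1 v).
  rewrite rnormZ rlam; have := HMS v; have := P1b v; have := P2b v.
  by rewrite /=; lra.
- apply: (mixing_of_paths bx lam1) => k.
    (* The preimage comes from cut 1 at the index 0, from cut [j.+2] just after cut [j], and from
       the preceding vector otherwise. *)
    have [ek|[k' ek']] := eP k.
      exists (kap 1%N), (dj 1%N)%:C; split; first exact: djC.
      by apply: (etrans (Lcut 1%N)); rewrite /= ek.
    have [/asboolP [j jk']|/Lnocut [mu mu0 Lk']] := boolP (cut k').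
      exists (kap j.+2), (dj j.+2)%:C; split; first exact: djC.
      by apply: (etrans (Lcut j.+2)); rewrite /= jk' ek' subrK.
    by exists k', mu; split=> //; apply: (etrans Lk'); rewrite /= ek' subrK.
  pose nil v := exists p, iter p L v = 0.
  have nilL v mu : nil v -> nil (mu *: v).
    by move=> [p Lp]; exists p; rewrite iter_linearZ Lp scaler0.
  have nilS v : nil (L v) -> nil v by move=> [p Lp]; exists p.+1; rewrite iterSr.
  (* Walking right from [k1] meets a cut at [kap j] at the latest, and the first cut met has index
     at most [j]. *)
  have block j : (forall i, (i <= j)%N -> nil (y (e (kap i)))) ->
      forall k, e k <= e (kap j) -> nil (y (e k)).
    move=> nilj k1 k1j.
    have [n k1n] : exists n : nat, e (kap j) = e k1 + n%:Z.
      by exists `|e (kap j) - e k1|%N; lia.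
    elim: n k1 k1n {k1j} => [|n IH] k1 k1n.
      by move: k1n; rewrite addr0 => <-; exact: nilj.
    have [/asboolP [i ik]|/Lnocut [mu mu0 Lk1]] := boolP (cut k1).
      rewrite -ik; apply: nilj; rewrite leqNgt; apply/negP => /kap_lt.
      by rewrite ik; lia.
    apply: nilS; rewrite Lk1; apply: nilL.
    by have [k2 ek2] := eS k1; rewrite -ek2; apply: IH; lia.
  (* Strong induction on the cut index: the target of cut [j.+2] lies at or before cut [j.+1]. *)
  have nilkap j : nil (y (e (kap j))).
    elim/ltn_ind: j => j IH; apply: nilS; rewrite Lcut; apply: nilL.
    case: j IH => [|[|j]] IH /=; first by exists 0%N.
      by rewrite -ek0; apply: (block 0%N); [move=> i i0; apply: IH|rewrite ek0].
    have [k1 ek1] := eS (kap j); rewrite -ek1; apply: (block j.+1).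
      by move=> i ij; apply: IH.
    by have := kapS j; lia.
  apply: (block `|e k|%N) => [i _|]; first exact: nilkap.
  by have := kap_ge `|e k|%N; lia.
- have eM : 2 * M * (2 * d) + 2 * M * d = eps / 2.
    by rewrite /d; field; rewrite gt_eqF.
  have eps2 : eps / 2 < eps by lra.
  apply: le_lt_trans eps2; apply: opnorm_le => [|v]; first by lra.
  rewrite /= opprD addrACA subrr add0r -eM mulrDl.
  rewrite (_ : _ - _ = P1 v + P2 v).
    by rewrite (le_trans (rnormD _ _))// lerD.
  by rewrite addrC -addrA addKr.
Qed.

End Paths.


(** * Quasinilpotent shifts have small weights arbitrarily far out *)

Lemma injective_unbounded (c : nat -> nat) : injective c ->
  forall N, exists k, (N <= c k)%N.
Proof.
move=> cI N; apply: contrapT => h.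
have cN k : (c k < N)%N.
  by rewrite ltnNge; apply/negP => Nk; apply: h; exists k.
have inj : injective (fun k : 'I_N.+1 => Ordinal (cN k)).
  by move=> i j [/cI] /val_inj.
by have := leq_card _ inj; rewrite !card_ord ltnn.
Qed.

Section Quasinilpotent.
Context {R : realType} {X : completeNormedModType R[i]}.
Local Notation C := R[i].
Variables (x : nat -> X) (bx : schauder_basis x) (nx : normalised x).
Variables (S : {linear X -> X}) (bS : bounded_operator S).
Variables (c : nat -> nat) (W : nat -> C).
Hypothesis cI : injective c.
Hypothesis Sc : forall k, S (x (c k)) = W k *: x (c k.+1).

(** This is the closed span of the chain, described by coordinates. *)
Let Y (v : X) := forall n, (forall k, c k <> n) -> coef bx n v = 0.

Lemma on_chainP a u v : Y u -> Y v -> Y (a *: u + v).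
Proof. by move=> Yu Yv n nc; rewrite linearD linearZ/= Yu// Yv// scaler0 addr0. Qed.

(** The iteration of [a] to [v + B a] from 0 stays in [Y] and converges to [u]; coefficients are
    continuous, so [Y] is closed. *)
Lemma on_chain_fixpoint (B : {linear X -> X}) (q : R) u v :
  0 <= q < 1 -> (forall v, rnorm (B v) <= q * rnorm v) ->
  (forall v, Y v -> Y (B v)) -> Y v -> u = v + B u -> Y u.
Proof.
move=> /andP[q0 q1] Bq BY Yv uE.
have approx j : exists2 a, Y a & rnorm (u - a) <= q ^+ j * rnorm u.
  elim: j => [|j [a Ya ua]].
    by exists 0; [move=> n _; rewrite linear0 | rewrite subr0 expr0 mul1r].
  exists (v + B a).
    by rewrite -[v]scale1r; apply: on_chainP => //; exact: BY.
  rewrite {1}uE opprD addrACA subrr add0r -linearB.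
  by rewrite (le_trans (Bq _))// exprS -mulrA ler_wpM2l.
have [M M0 HM] := coef_bounded bx nx.
move=> n nc; apply/eqP; rewrite -rnorm_eq0 eq_le rnorm_ge0 andbT.
have lim : (fun j => M * rnorm u * q ^+ j) @ \oo --> (0 : R).
  rewrite -(mulr0 (M * rnorm u)); apply: cvgM; first exact: cvg_cst.
  by apply: cvg_expr; rewrite ger0_norm.
apply/ler_addgt0Pr => eps eps0.
move/cvgrPdist_lt: lim => /(_ _ eps0) [j _ /(_ j (leqnn _))].
rewrite sub0r normrN add0r => /(le_lt_trans (ler_norm _)) /ltW; apply: le_trans.
have [a Ya ua] := approx j.
have -> : coef bx n u = coef bx n (u - a) by rewrite linearB/= Ya// subr0.
by rewrite (le_trans (HM _ _))// -mulrA ler_wpM2l ?(ltW M0)// mulrC.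
Qed.

Lemma coef_image n v :
  (fun N => \sum_(0 <= m < N) coef bx m v * coef bx n (S (x m)) : C^o) @ \oo
    --> (coef bx n (S v) : C^o).
Proof.
have [M M0 HM] := coef_bounded bx nx.
have [MS MS0 HMS] := (boundedE _).1 bS.
have /cvg_rnorm0 lim := @psum_cvg _ _ _ bx v.
apply: (@cvg_rnorm_squeeze _ (C^o) _ _ (fun N => M * MS * rnorm (psum bx N v - v))).
  move=> N; rewrite (_ : _ - _ = coef bx n (S (psum bx N v - v))).
    by rewrite (le_trans (HM _ _))// -mulrA ler_wpM2l// ltW.
  rewrite !linearB/= /psum !linear_sum/=; congr (_ - _).
  by apply: eq_bigr => m _; rewrite !linearZ.
by rewrite -(mulr0 (M * MS)); apply: cvgM lim; exact: cvg_cst.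
Qed.

(** Only the indices [c k.+1] are excluded: [n = c 0] is allowed and starts the recursion for the
    resolvent coefficients. *)
Lemma coef_image_eq0 n v : Y v -> (forall k, c k.+1 <> n) -> coef bx n (S v) = 0.
Proof.
move=> Yv nc; apply: (cvg_unique _ (@coef_image n v)) => //.
rewrite (_ : (fun N => _) = fun=> 0); first exact: cvg_cst.
apply/funext => N; rewrite big1// => m _.
have [[k <-]|mc] := pselect (exists k, c k = m).
  rewrite Sc linearZ/= coef_basis (_ : (_ == _) = false) ?scaler0 ?mulr0//.
  by apply/eqP => /esym; exact: nc.
by rewrite Yv ?mul0r// => k km; apply: mc; exists k.
Qed.

Lemma coef_imageS k v : Y v ->
  coef bx (c k.+1) (S v) = W k * coef bx (c k) v.
Proof.
move=> Yv; apply: (cvg_unique _ (@coef_image _ v)) => //.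
apply/(@cvg_rnormP _ (C^o)) => e e0; exists (c k).+1 => N kN.
have z m : m != c k -> coef bx m v * coef bx (c k.+1) (S (x m)) = 0.
  move=> mk; have [[j jm]|mc] := pselect (exists k, c k = m).
    rewrite -jm Sc linearZ/= coef_basis (inj_eq cI) eqSS.
    rewrite eq_sym -(inj_eq cI) jm (negbTE mk).
    by rewrite scaler0 mulr0.
  by rewrite Yv ?mul0r// => j jm; apply: mc; exists j.
rewrite (bigD1_seq (c k)) ?iota_uniq ?mem_index_iota//= big1_seq; last first.
  by move=> m /andP[mk _]; exact: z.
rewrite Sc linearZ/= coef_basis eqxx addr0 [_ *: _]mulr1 mulrC subrr rnorm0.
by [].
Qed.

Lemma on_chain_image v : Y v -> Y (S v).
Proof. by move=> Yv n nc; apply: coef_image_eq0 => // k; exact: nc. Qed.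

(* The resolvent at [z > 0] maps the closed span of the chain into itself: this
   is clear for large [z] (Neumann series) and propagates down to [0] by
   connectedness. *)
Lemma resolvent_on_chain (A : R -> {linear X -> X}) :
  (forall s, 0 < s -> [/\ bounded_operator (A s),
     forall v, A s (s%:C *: v - S v) = v & forall v, s%:C *: A s v - S (A s v) = v]) ->
  forall s, 0 < s -> forall v, Y v -> Y (A s v).
Proof.
move=> AP.
have Alin a b u v : A a (u + b *: v) = A a u + b *: A a v.
  by rewrite linearD linearZ.
(* By the resolvent identity, [A s v] is the fixed point of the contraction taking [u] to
   [A r v + (r - s) A r u]. *)
have prop r s Mr : 0 < r -> 0 < s -> (forall v, rnorm (A r v) <= Mr * rnorm v) ->
    `|r - s| * Mr < 1 -> (forall v, Y v -> Y (A r v)) ->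
    forall v, Y v -> Y (A s v).
  move=> r0 s0 HMr rs Yr v Yv.
  have [_ Ar _] := AP _ r0; have [_ _ As] := AP _ s0.
  have Mr0 : 0 <= `|r - s| * Mr.
    rewrite mulr_ge0//; have := HMr (x 0%N); rewrite rnorm_basis// mulr1.
    by apply: le_trans; exact: rnorm_ge0.
  apply: (@on_chain_fixpoint (((r - s)%:C \*: A r) : {linear X -> X})
    (`|r - s| * Mr) _ (A r v)).
  - by rewrite Mr0.
  - by move=> u; rewrite /= rnormZ rnorm_real -mulrA ler_wpM2l.
  - by move=> u Yu n nc; rewrite /= linearZ/= Yr// scaler0.
  - exact: Yr.
  - rewrite /= -Alin -{1}(Ar (A s v)); congr (A r _).
    rewrite -[X in _ = X + _](As v) rmorphB/= scalerBl.
    by rewrite [RHS]addrC addrA subrK.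
(* The resolvent identity gives [rnorm (A r v) <= Ms * rnorm v + rnorm (A r v) / 2]. *)
have near_bound r s Ms : 0 < r -> 0 < s ->
    (forall v, rnorm (A s v) <= Ms * rnorm v) -> `|r - s| * Ms <= 1 / 2 ->
    forall v, rnorm (A r v) <= 2 * Ms * rnorm v.
  move=> r0 s0 HMs rs v.
  have [_ As _] := AP _ s0; have [_ _ Ar] := AP _ r0.
  have e : A r v = A s (v + (s - r)%:C *: A r v).
    rewrite -{1}(As (A r v)); congr (A s _).
    rewrite -[X in _ = X + _](Ar v) rmorphB/= scalerBl.
    by rewrite [RHS]addrC addrA subrK.
  have := HMs ((s - r)%:C *: A r v); have := HMs v.
  have := rnormD (A s v) (A s ((s - r)%:C *: A r v)).
  rewrite -linearD -e rnormZ rnorm_real distrC.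
  have := ler_wpM2r (rnorm_ge0 (A r v)) rs; lra.
have [MS MS0 HMS] := (boundedE _).1 bS.
have large s : MS < s -> forall v, Y v -> Y (A s v).
  move=> MSs v Yv; have s0 : 0 < s by exact: lt_trans MSs.
  have [_ _ As] := AP _ s0.
  apply: (@on_chain_fixpoint (((s^-1)%:C \*: S) : {linear X -> X}) (MS / s) _
    ((s^-1)%:C *: v)).
  - by rewrite divr_ge0 ?ltW//= ltr_pdivrMr// mul1r.
  - move=> u; rewrite /= rnormZr ?invr_ge0 ?(ltW s0)//.
    by rewrite mulrC mulrAC ler_wpM2r ?invr_ge0 ?(ltW s0)//.
  - by move=> u Yu n nc; rewrite /= linearZ/= on_chain_image// scaler0.
  - by move=> n nc; rewrite linearZ/= Yv// scaler0.
  - rewrite /= -scalerDr -[X in X + _](As v) subrK scalerA -rmorphM/=.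
    by rewrite mulVf ?gt_eqF// scale1r.
move=> s0 s00; apply: contrapT => nG.
(* If the claim fails at [s0], then [s0] bounds [E] from below, so its infimum is positive. *)
pose E := [set r : R | 0 < r /\ forall s, r <= s -> forall v, Y v -> Y (A s v)].
have Elb : lbound E s0.
  move=> r [r0 Hr]; rewrite leNgt; apply/negP => rs.
  by apply: nG; apply: Hr; exact: ltW.
have Einf : has_inf E.
  split; last by exists s0.
  exists (MS + 1); split; first by rewrite addr_gt0.
  by move=> s MSs; apply: large; lra.
pose g := inf E.
have sg : s0 <= g by apply: lb_le_inf => //; case: Einf.
have g0 : 0 < g by exact: lt_le_trans sg.
have [bg _ _] := AP _ g0; have [Mg Mg0 HMg] := (boundedE _).1 bg.
(* The resolvent at [g + h] is bounded by [2 * Mg], and [h * (2 * Mg) = 1 / 2], so [prop] leads from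
   [g + h] to [g], and then from [g] down to [g - h]. *)
pose h := (4 * Mg)^-1.
have h0 : 0 < h by rewrite invr_gt0 mulr_gt0.
have hM : h * Mg = 1 / 4 by rewrite /h; field; rewrite gt_eqF.
have above s : g < s -> forall v, Y v -> Y (A s v).
  move=> gs; have [|r [_ Hr] rs] := inf_adherent (_ : 0 < s - g) Einf.
    by rewrite subr_gt0.
  by apply: Hr; move: rs; rewrite -/g; lra.
have at_g : forall v, Y v -> Y (A g v).
  have gh0 : 0 < g + h by rewrite addr_gt0.
  have hn : `|g + h - g| = h by rewrite addrAC subrr add0r gtr0_norm.
  apply: (@prop (g + h) g (2 * Mg)) => //.
  - by apply: near_bound HMg _ => //; rewrite hn hM; lra.
  - by rewrite hn; lra.
  - by apply: above; lra.
(* The maximum with [g / 2] keeps this point positive; it lies below the infimum [g]. *)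
have : E (Num.max (g - h) (g / 2)).
  split; first by rewrite lt_max divr_gt0 ?orbT.
  move=> s; rewrite ge_max => /andP[s1 s2].
  have [gs|sg'|<-//] := ltgtP g s; first exact: above.
  apply: (prop g s Mg) => //; first by lra.
  rewrite (@le_lt_trans _ _ (1 / 4))//; last by lra.
  by rewrite -hM ler_wpM2r ?(ltW Mg0)// ger0_norm; lra.
move=> /(ge_inf (proj2 Einf)); rewrite -/g le_max => /orP[]; lra.
Qed.

(** The coefficients [a k] of the resolvent at [d] applied to [x (c 0)] satisfy [a 0 = 1 / d] and
    [d * a k.+1 = W k * a k], so their moduli never decrease. *)
Lemma quasinilpotent_chain (d : R) : 0 < d -> (forall k, d <= rnorm (W k)) ->
  ~ quasinilpotent S.
Proof.
move=> d0 dW qS.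
have res (s : R) : exists A : {linear X -> X}, 0 < s -> [/\ bounded_operator A,
    forall v, A (s%:C *: v - S v) = v & forall v, s%:C *: A v - S (A v) = v].
  have [s0|s0] := pselect (0 < s); last by exists S.
  have : ~ spectrum S s%:C.
    rewrite qS /= => /eqP; rewrite (inj_eq (@complexI R) _ 0).
    by rewrite gt_eqF.
  by move=> /contrapT [A AP]; exists A.
have [A AP] := choice res.
have [_ _ Ad] := AP _ d0.
pose v := A d (x (c 0%N)).
have Yv : Y v.
  apply: (resolvent_on_chain AP) => // n nc.
  by rewrite coef_basis; case: eqP => // /esym /nc.
have dv n : d%:C * coef bx n v - coef bx n (S v) = (n == c 0%N)%:R.
  by rewrite -(coef_basis bx) -(Ad (x (c 0%N))) linearB/= linearZ.
have dC : d%:C != 0 by rewrite -rnorm_gt0 rnorm_real normr_gt0 gt_eqF.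
have big k : d^-1 <= rnorm (coef bx (c k) v : C).
  elim: k => [|k IH].
    have := dv (c 0%N); rewrite coef_image_eq0// ?eqxx; last by move=> k /cI.
    rewrite subr0 => h; have -> : coef bx (c 0%N) v = d%:C^-1.
      by apply: (mulfI dC); rewrite h mulfV.
    by rewrite rnormV rnorm_real gtr0_norm.
  have := dv (c k.+1); rewrite coef_imageS// (inj_eq cI)/= => /eqP.
  rewrite subr_eq0 => /eqP /(congr1 (@rnorm R C)).
  rewrite !rnormM rnorm_real gtr0_norm// => h.
  rewrite -(ler_pM2l d0) h.
  by apply: ler_pM => //; rewrite ?invr_ge0 ltW.
(* Consecutive partial sums far out differ by less than [d^-1], contradicting [big]. *)
have /cvg_rnormP /(_ (d^-1 / 2)) [|N HN] := @psum_cvg _ _ _ bx v.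
  by rewrite divr_gt0// invr_gt0.
have [k Nk] := injective_unbounded cI N.
have h1 := HN _ Nk; have h2 := HN _ (leqW Nk).
have := rdistD (psum bx (c k).+1 v) v (psum bx (c k) v).
rewrite (rdistC v) /psum big_nat_recr//= addrAC subrr add0r.
rewrite rnormZ rnorm_basis// mulr1.
move: h1 h2 (big k); rewrite /psum big_nat_recr//=; lra.
Qed.

End Quasinilpotent.

Section Shift.
Context {R : realType} {X : completeNormedModType R[i]}.
Local Notation C := R[i].

(** Otherwise the indices from [|N|] on form a chain with weights at least [eps]; being nonnegative,
    they all lie in the range of [e]. *)
Lemma quasinilpotent_shift (e : nat -> int) (y : int -> X) (w : int -> C)
    (S : {linear X -> X}) :
  injective e -> (exists k, e k = 0) ->
  (forall k, exists k', e k' = e k + 1) ->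
  normalised y -> schauder_basis (y \o e) -> bounded_operator S ->
  (forall k, S (y (e k)) = w (e k) *: y (e k + 1)) ->
  quasinilpotent S ->
  forall (eps : R) (N : int), 0 < eps ->
     exists k, N <= e k /\ rnorm (w (e k)) < eps.
Proof.
move=> eI [k0 ek0] eS ny bx bS Sy qS eps N eps0; apply: contrapT => h.
have en (n : nat) : exists k, e k = n%:Z.
  elim: n => [|n [k ek]]; first by exists k0.
  by have [k' ek'] := eS k; exists k'; rewrite ek' ek; lia.
have [c cP] := choice (fun j => en (`|N| + j)%N).
have cI : injective c.
  by move=> i j /(congr1 e); rewrite !cP; lia.
have nx : normalised (y \o e) by move=> k; exact: ny.
apply: (@quasinilpotent_chain _ _ _ bx nx S bS c (fun j => w (e (c j))) cI _ eps eps0) => //.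
  by move=> k; rewrite /= Sy !cP; congr (_ *: y _); lia.
move=> k; rewrite leNgt; apply/negP => lt; apply: h; exists (c k).
by split=> //; rewrite cP; lia.
Qed.

End Shift.


(** * Application to forward and bilateral shifts *)

Lemma homo_ltn_ge (n : nat -> nat) :
  {homo n : i j / (i < j)%N >-> (i < j)%N} -> forall j, (j <= n j)%N.
Proof.
move=> nS; elim=> // j IH.
exact: leq_ltn_trans IH (nS _ _ (ltnSn j)).
Qed.

Lemma homo_ltz_ge (n : nat -> int) :
  {homo n : i j / (i < j)%N >-> i < j} -> forall j, n 0%N + j%:Z <= n j.
Proof.
move=> nS; elim=> [|j IH]; first by rewrite addr0.
by have := nS _ _ (ltnSn j); lia.
Qed.

Theorem corollary3p4 (R : realType) (X : completeNormedModType R[i])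
    (Xsep : separable X) (Xinf : infinite_dimensional X)
    (Xbasis : exists x : nat -> X, schauder_basis x)
    (lambda : R[i]) (lambda1 : `|lambda| = 1) (S : {linear X -> X}) :
  ((exists (x : nat -> X) (w : nat -> R[i]),
      [/\ normalised x, forward_shift x w S & weights_vanish_nat w]) \/
   (exists (x : int -> X) (w : int -> R[i]),
      [/\ normalised x, bilateral_shift x w S & weights_vanish_int w]) ->
   opnorm_closure [set T | mixing T] ((lambda \*: idfun) \+ S))
  /\
  (quasinilpotent S ->
   (exists (x : nat -> X) (w : nat -> R[i]),
      normalised x /\ forward_shift x w S) \/
   (exists (x : int -> X) (w : int -> R[i]),
      normalised x /\ bilateral_shift x w S) ->
   opnorm_closure [set T | mixing T] ((lambda \*: idfun) \+ S)).
Proof.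
have small (u : nat -> R[i]) : (fun j => `|u j| : R[i]^o) @ \oo --> (0 : R[i]^o) ->
    forall (eps : R), 0 < eps -> exists N, forall j, (N <= j)%N -> rnorm (u j) < eps.
  move=> /cvg_rnormP u0 eps /u0 [N HN]; exists N => j /HN.
  by rewrite subr0 /rnorm normr_id.
have PoszI : injective Posz by move=> i j [].
have Posz0 : exists k, Posz k = 0 by exists 0%N.
have PoszS k : exists k', Posz k' = Posz k + 1 by exists k.+1; lia.
have PoszP k : Posz k = 0 \/ exists k', Posz k' = Posz k - 1.
  by case: k => [|k]; [left | right; exists k; lia].
split=> [[[x [w [nx [bS bx Sx] [n [nS nw]]]]]|[x [w [nx [bS [e be bx] Sx] [n [nS nw]]]]]]
  |qS [[x [w [nx [bS bx Sx]]]]|[x [w [nx [bS [e be bx] Sx]]]]]].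
(* The absolute value extends the one-sided family to the integers; only its values on the range of
   [Posz] matter. *)
- apply: (@shift_mixing_closure _ _ Posz (fun k => x `|k|%N) (fun k => w `|k|%N)) => //.
    by move=> k; rewrite Sx; congr (_ *: x _); lia.
  move=> eps N /(small _ nw) [J HJ]; pose j := maxn J `|N|%N.
  exists (n j); split; last by apply: HJ; exact: leq_maxl.
  by have := homo_ltn_ge nS j; rewrite /j; lia.
- have [e' eK e'K] := be.
  apply: (@shift_mixing_closure _ _ e x w) => //.
  + exact: can_inj eK.
  + by exists (e' 0).
  + by move=> k; exists (e' (e k + 1)).
  + by move=> k; right; exists (e' (e k - 1)).
  (* Since [n j >= n 0 + j], this [j] ensures [n j >= N], even when [n 0] is negative. *)
  move=> eps N /(small _ nw) [J HJ]; pose j := maxn J `|N - n 0%N|%N.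
  exists (e' (n j)); rewrite e'K; split; last by apply: HJ; exact: leq_maxl.
  by have := homo_ltz_ge nS j; rewrite /j; lia.
- have Sy (k : nat) : S (x (absz k)) = w (absz k) *: x (absz (k%:Z + 1)).
    by rewrite Sx; congr (_ *: x _); lia.
  apply: (@shift_mixing_closure _ _ Posz (fun k => x `|k|%N) (fun k => w `|k|%N)) => //.
  apply: (@quasinilpotent_shift _ _ Posz (fun k => x `|k|%N) (fun k => w `|k|%N)
    S PoszI Posz0 PoszS _ bx bS Sy qS).
  by move=> k; exact: nx.
- have [e' eK e'K] := be.
  have e0 : exists k, e k = 0 by exists (e' 0).
  have eS k : exists k', e k' = e k + 1 by exists (e' (e k + 1)).
  apply: (@shift_mixing_closure _ _ e x w) => //.
  + exact: can_inj eK.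
  + by move=> k; right; exists (e' (e k - 1)).
  exact: (quasinilpotent_shift (can_inj eK) e0 eS nx bx bS).
Qed.
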